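(* Let $1<p<\infty$. Then $$[(\mathcal{N}^p)^{-1}\circ\mathcal{H}_{v\mathcal{N}_p}^\infty,\|\cdot\|_{(\mathcal{N}^p)^{-1}\circ\mathcal{H}_{v\mathcal{N}_p}^\infty}]=[\mathcal{H}_v^\infty,\|\cdot\|_v].$$ That is, for every open subset $U$ of a complex Banach space, every weight $v$ on $U$, every complex Banach space $F$ and every $f\in\mathcal{H}_v^\infty(U,F)$, the map $A\circ f$ is a right $p$-nuclear weighted holomorphic mapping for every complex Banach space $G$ and every right $p$-nuclear operator $A\in\mathcal{N}^p(F,G)$, and $\|f\|_{(\mathcal{N}^p)^{-1}\circ\mathcal{H}_{v\mathcal{N}_p}^\infty}=\|f\|_v$.
   Context: All Banach spaces are complex. A weight $v$ on an open subset $U$ of a Banach space is a strictly positive continuous function on $U$. $\mathcal{H}_v^\infty(U,F)$ is the Banach space of holomorphic $f:U\to F$ with $\|f\|_v:=\sup_{x\in U}v(x)\|f(x)\|<\infty$, and $\mathcal{H}_v^\infty(U)=\mathcal{H}_v^\infty(U,\mathbb{C})$. Let $1/p+1/p^*=1$. For a sequence $(z_n)$ in a Banach space $Z$, $\|(z_n)\|_p=(\sum\|z_n\|^p)^{1/p}$ and $\|(z_n)\|_{p^*}^w=\sup_{\varphi\in B_{Z^*}}(\sum|\varphi(z_n)|^{p^*})^{1/p^*}$; $(z_n)$ is $p$-summable (weakly $p^*$-summable) if the corresponding quantity is finite. $f\in\mathcal{H}_v^\infty(U,F)$ is right $p$-nuclear if there are a weakly $p^*$-summable sequence $(g_n)$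 in $\mathcal{H}_v^\infty(U)$ and a $p$-summable sequence $(y_n)$ in $F$ with $f=\sum_n g_n\cdot y_n$ in $(\mathcal{H}_v^\infty(U,F),\|\cdot\|_v)$, where $(g\cdot y)(x)=g(x)y$. $\mathcal{H}_{v\mathcal{N}_p}^\infty(U,F)$ is the space of all such $f$ with $\|f\|_{\mathcal{H}_{v\mathcal{N}_p}^\infty}:=\inf\|(g_n)\|_{p^*}^w\|(y_n)\|_p$ over all such representations. Likewise, $\mathcal{N}^p(F,G)$ is the space of right $p$-nuclear linear operators $A:F\to G$, i.e. those with a representation $A=\sum_n x_n^*(\cdot)\,y_n$ converging in operator norm, with $(x_n^* )$ weakly $p^*$-summable in $F^*$ and $(y_n)$ $p$-summable in $G$, and $\|A\|_{\mathcal{N}^p}:=\inf\|(x_n^* )\|_{p^*}^w\|(y_n)\|_p$ over all such representations. The left-hand quotient $(\mathcal{N}^p)^{-1}\circ\mathcal{H}_{v\mathcal{N}_p}^\infty(U,F)$ is the set of $f\in\mathcal{H}_v^\infty(U,F)$ such that $A\circ f\in\mathcal{H}_{v\mathcal{N}_p}^\infty(U,G)$ for every Banach space $G$ and every $A\in\mathcal{N}^p(F,G)$, with norm $\sup\{\|A\circ f\|_{\mathcal{H}_{v\mathcal{N}_p}^\infty}:A\in\mathcal{N}^p(F,G),\ \|A\|_{\mathcal{N}^p}\le1\}$, $G$ ranging over all Banach spaces. *)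

(* Defs.v *)
From HB Require Import structures.
From mathcomp Require Import all_boot all_order all_algebra complex.
From mathcomp Require Import all_classical all_reals all_analysis.

Set Implicit Arguments.
Unset Strict Implicit.
Unset Printing Implicit Defensive.

Import Order.TTheory GRing.Theory Num.Theory.
Import numFieldNormedType.Exports.

Local Open Scope classical_set_scope.
Local Open Scope ring_scope.

(* A complex Banach space is a [completeNormedModType R[i]] with [R : realType].
   Its library norm takes values in [R[i]]; [rnorm] is that norm as a real. *)
Definition rnorm (R : realType) (Z : normedModType R[i]) (z : Z) : R :=
  complex.Re `|z|.

Lemma rcD (R : realType) (x y : R) : (x + y)%:C%C = x%:C%C + y%:C%C :> R[i].
Proof. exact: rmorphD. Qed.

Lemma rcM (R : realType) (x y : R) : (x * y)%:C%C = x%:C%C * y%:C%C :> R[i].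
Proof. exact: rmorphM. Qed.

Section rnorm_theory.
Context {R : realType} {Z : normedModType R[i]}.
Implicit Types x y : Z.

Lemma rnormC x : (rnorm x)%:C%C = `|x|.
Proof. by apply: RRe_real; apply: ger0_real. Qed.

Lemma rnorm_ge0 x : 0 <= rnorm x.
Proof. by rewrite -lecR rnormC; exact: normr_ge0. Qed.

Lemma rnorm_eq0 x : rnorm x = 0 -> x = 0.
Proof. by move=> x0; apply/eqP; rewrite -normr_eq0 -rnormC x0. Qed.

Lemma rnorm0 : rnorm (0 : Z) = 0.
Proof. by rewrite /rnorm normr0. Qed.

Lemma ler_rnormD x y : rnorm (x + y) <= rnorm x + rnorm y.
Proof. by rewrite -lecR rcD !rnormC ler_normD. Qed.

Lemma rnormZ (a : R[i]) x : rnorm (a *: x) = rnorm (a : R[i]^o) * rnorm x.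
Proof. by apply: complexI; rewrite rcM !rnormC normrZ. Qed.

End rnorm_theory.

Lemma rnorm_rc (R : realType) (r : R) : 0 <= r -> rnorm (r%:C%C : R[i]^o) = r.
Proof.
by move=> r0; apply: complexI; rewrite rnormC; apply: ger0_norm; rewrite lecR.
Qed.

Section sup_lemmas.
Context {R : realType} {T : Type}.
Implicit Types (D : set T) (f g : T -> R).

Definition bounded_on D f := exists M, forall x, D x -> f x <= M.

Lemma sup_ubound D f x : bounded_on D f -> D x -> f x <= sup [set f y | y in D].
Proof.
move=> [M fM] Dx; apply: ub_le_sup; last by exists x.
by exists M => _ [y Dy <-]; exact: fM.
Qed.

Lemma sup_le_bound D f M : 0 <= M -> (forall x, D x -> f x <= M) ->
  sup [set f y | y in D] <= M.
Proof.
move=> M0 fM; have [->|/set0P[x Dx]] := eqVneq D set0.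
  by rewrite image_set0 sup0.
by apply: ge_sup; [exists (f x), x|move=> _ [y Dy <-]; exact: fM].
Qed.

Lemma sup_image_ge0 D f : (forall x, D x -> 0 <= f x) -> bounded_on D f ->
  0 <= sup [set f y | y in D].
Proof.
move=> f0 fb; have [->|/set0P[x Dx]] := eqVneq D set0.
  by rewrite image_set0 sup0.
exact: le_trans (f0 _ Dx) (sup_ubound fb Dx).
Qed.

Lemma sup_imageM D f (k : R) : 0 <= k -> (forall x, D x -> 0 <= f x) ->
  bounded_on D f ->
  sup [set k * f y | y in D] = k * sup [set f y | y in D].
Proof.
move=> k0 f0 fb; apply/eqP; rewrite eq_le; apply/andP; split.
  apply: sup_le_bound; first by rewrite mulr_ge0// sup_image_ge0.
  by move=> x Dx; rewrite ler_wpM2l// sup_ubound.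
have [kE|kN0] := eqVneq k 0.
  rewrite kE mul0r; apply: sup_image_ge0; first by move=> x _; rewrite mul0r.
  by exists 0 => x _; rewrite mul0r.
have {kN0}k0 : 0 < k by rewrite lt_neqAle eq_sym kN0.
rewrite -ler_pdivlMl//; apply: sup_le_bound.
  rewrite mulr_ge0 ?invr_ge0 ?(ltW k0)// sup_image_ge0//.
    by move=> x Dx; rewrite mulr_ge0 ?(ltW k0)// f0.
  have [M fM] := fb; exists (k * M) => x Dx.
  by rewrite ler_wpM2l ?(ltW k0)// fM.
move=> x Dx; rewrite ler_pdivlMl//.
apply: (@sup_ubound _ (fun y => k * f y)) => //.
have [M fM] := fb; exists (k * M) => y Dy.
by rewrite ler_wpM2l ?(ltW k0)// fM.
Qed.

End sup_lemmas.

Section blin_def.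
Context {R : realType} {E F : normedModType R[i]}.

Definition is_blin (f : E -> F) : Prop := linear f /\ continuous f.

Definition blin_pred : {pred E -> F} := [pred f | `[< is_blin f >]].

Lemma blin_submod_closed : submod_closed blin_pred.
Proof.
split.
  apply/asboolP; split; last by move=> x; exact: cvg_cst.
  by move=> a x y; rewrite -[RHS]/(a *: (0 : F) + 0) scaler0 addr0.
move=> a f g /asboolP[fl fc] /asboolP[gl gc]; apply/asboolP; split.
  move=> k x y; have fE z : (a *: f + g) z = a *: f z + g z by [].
  by rewrite !fE fl gl !scalerDr !scalerA mulrC addrACA.
move=> x; apply: cvgD; last exact: gc.
by apply: cvgZl_tmp; exact: fc.
Qed.

HB.instance Definition _ :=
  GRing.isSubmodClosed.Build _ _ blin_pred blin_submod_closed.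

End blin_def.

(* The normed space of continuous linear operators [E -> F], with the operator
   norm [opnorm]. *)
Record blin (R : realType) (E F : normedModType R[i]) := Blin {
  blin_fun :> E -> F ;
  _ : blin_fun \in blin_pred }.

Section blin_lmod.
Context (R : realType) (E F : normedModType R[i]).

HB.instance Definition _ := [isSub for @blin_fun R E F].
HB.instance Definition _ := [Choice of blin E F by <:].
HB.instance Definition _ := [SubChoice_isSubLmodule of blin E F by <:].

Lemma blinP (A : blin E F) : is_blin A.
Proof. by apply/asboolP; exact: (valP A). Qed.

HB.instance Definition _ (A : blin E F) :=
  GRing.isLinear.Build _ _ _ _ (blin_fun A) (blinP A).1.

Lemma blin_ext (A B : blin E F) : A =1 B -> A = B.
Proof. by move=> AB; apply/val_inj/funext. Qed.

Definition mk_blin (f : E -> F) (fP : is_blin f) : blin E F := Blin (asboolT fP).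

Definition opnorm (A : blin E F) : R :=
  sup [set rnorm (A x) | x in [set x | rnorm x <= 1]].

Lemma blin_lipschitz (A : blin E F) :
  exists2 k : R, 0 < k & forall x, rnorm (A x) <= k * rnorm x.
Proof.
have [k k0 Ak] := @linear_lipschitz _ _ _ A (blinP A).2.
have kE : (complex.Re k)%:C%C = k by apply: RRe_real; apply: gtr0_real.
exists (complex.Re k); first by rewrite -ltcR kE; exact: k0.
by move=> x; rewrite -lecR rcM !rnormC kE; exact: Ak.
Qed.

Lemma blin_bounded (A : blin E F) :
  bounded_on [set x | rnorm x <= 1] (fun x => rnorm (A x)).
Proof.
have [k k0 Ak] := blin_lipschitz A; exists k => x x1.
by rewrite (le_trans (Ak x))// ler_piMr// ltW.
Qed.

Lemma opnorm_ge0 (A : blin E F) : 0 <= opnorm A.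
Proof.
by apply: (sup_image_ge0 _ (blin_bounded A)) => x _; exact: rnorm_ge0.
Qed.

Lemma opnorm_bound (A : blin E F) x : rnorm (A x) <= opnorm A * rnorm x.
Proof.
have [x0|] := eqVneq (rnorm x) 0.
  by rewrite x0 (rnorm_eq0 x0) linear0 rnorm0 mulr0.
move=> x0; have {}x0 : 0 < rnorm x by rewrite lt_neqAle eq_sym x0 rnorm_ge0.
have nV : rnorm ((rnorm x)^-1%:C%C : R[i]^o) = (rnorm x)^-1.
  by rewrite rnorm_rc// invr_ge0 ltW.
rewrite -ler_pdivrMr// mulrC.
rewrite (_ : _ * _ = rnorm (A ((rnorm x)^-1%:C%C *: x))); last first.
  by rewrite linearZ/= rnormZ nV.
apply: (sup_ubound (blin_bounded A)) => /=.
by rewrite rnormZ nV mulVf// gt_eqF.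
Qed.

Lemma ler_opnormD (A B : blin E F) : opnorm (A + B) <= opnorm A + opnorm B.
Proof.
apply: sup_le_bound; first by rewrite addr_ge0// opnorm_ge0.
move=> x x1; rewrite (le_trans (ler_rnormD _ _))// lerD//.
- exact: (sup_ubound (blin_bounded A)).
- exact: (sup_ubound (blin_bounded B)).
Qed.

Lemma opnormZ (a : R[i]) (A : blin E F) :
  opnorm (a *: A) = rnorm (a : R[i]^o) * opnorm A.
Proof.
rewrite /opnorm -sup_imageM ?rnorm_ge0//; last exact: blin_bounded.
- by congr (sup _); apply: eq_imagel => x _; exact: rnormZ.
- by move=> x _; exact: rnorm_ge0.
Qed.

Let blin_norm (A : blin E F) : R[i] := (opnorm A)%:C%C.

Let blin_normD A B : blin_norm (A + B) <= blin_norm A + blin_norm B.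
Proof. by rewrite -rcD lecR ler_opnormD. Qed.

Let blin_normZ (a : R[i]) A : blin_norm (a *: A) = `|a| * blin_norm A.
Proof. by rewrite /blin_norm opnormZ rcM rnormC. Qed.

Let blin_norm0_eq0 A : blin_norm A = 0 -> A = 0.
Proof.
move=> /(congr1 (@complex.Re R))/= A0; apply: blin_ext => x; apply: rnorm_eq0.
apply/eqP; rewrite eq_le rnorm_ge0 andbT.
by have := opnorm_bound A x; rewrite A0 mul0r.
Qed.

HB.instance Definition _ := Lmodule_isNormed.Build R[i] (blin E F)
  blin_normD blin_normZ blin_norm0_eq0.

Lemma rnorm_blinE (A : blin E F) : rnorm A = opnorm A.
Proof. by []. Qed.

End blin_lmod.

Record weight (R : realType) (E : normedModType R[i]) (U : set E) := Weight {
  weight_fun :> E -> R ;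
  weight_gt0 : forall x, U x -> 0 < weight_fun x ;
  weight_continuous : {within U, continuous weight_fun} }.

Section whol_def.
Context {R : realType} {E : normedModType R[i]} {U : set E}.
Context (v : weight U) {F : normedModType R[i]}.

(* A function on the open set [U] is encoded as a function on [E] vanishing
   outside [U], so that two functions agree on [U] iff they are equal.
   Holomorphic means complex Frechet differentiable at every point of [U]. *)
Definition is_whol (f : E -> F) : Prop :=
  [/\ forall x, U x -> differentiable f x,
      bounded_on U (fun x => v x * rnorm (f x)) &
      forall x, ~ U x -> f x = 0].

Definition whol_pred : {pred E -> F} := [pred f | `[< is_whol f >]].

Lemma whol_submod_closed : submod_closed whol_pred.
Proof.
split.
  apply/asboolP; split=> //.
  by exists 0 => x _; rewrite -[X in rnorm X]/(0 : F) rnorm0 mulr0.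
move=> a f g /asboolP[fd [M fM] f0] /asboolP[gd [N gN] g0].
have fE z : (a *: f + g) z = a *: f z + g z by [].
apply/asboolP; split.
- move=> x Ux; apply: differentiableD; last exact: gd.
  by apply: differentiableZ; exact: fd.
- exists (rnorm (a : R[i]^o) * M + N) => x Ux; rewrite fE.
  have v0 := ltW (weight_gt0 v Ux).
  rewrite (le_trans (ler_wpM2l v0 (ler_rnormD _ _)))// rnormZ mulrDr.
  by rewrite lerD ?gN// mulrCA ler_wpM2l ?rnorm_ge0// fM.
- by move=> x Ux; rewrite fE f0// g0// scaler0 addr0.
Qed.

HB.instance Definition _ :=
  GRing.isSubmodClosed.Build _ _ whol_pred whol_submod_closed.

End whol_def.

(* The weighted space of bounded holomorphic maps, with norm [wnorm]. *)
Record whol (R : realType) (E : normedModType R[i]) (U : set E) (v : weight U)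
    (F : normedModType R[i]) := Whol {
  whol_fun :> E -> F ;
  _ : whol_fun \in whol_pred v }.

Section whol_lmod.
Context (R : realType) (E : normedModType R[i]) (U : set E) (v : weight U).
Context (F : normedModType R[i]).

HB.instance Definition _ := [isSub for @whol_fun R E U v F].
HB.instance Definition _ := [Choice of whol v F by <:].
HB.instance Definition _ := [SubChoice_isSubLmodule of whol v F by <:].

Lemma wholP (f : whol v F) : is_whol v f.
Proof. by apply/asboolP; exact: (valP f). Qed.

Lemma whol_ext (f g : whol v F) : f =1 g -> f = g.
Proof. by move=> fg; apply/val_inj/funext. Qed.

Definition mk_whol (f : E -> F) (fP : is_whol v f) : whol v F :=
  Whol (asboolT fP).

Definition wnorm (f : whol v F) : R := sup [set v x * rnorm (f x) | x in U].

Lemma whol_bounded (f : whol v F) :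
  bounded_on U (fun x => v x * rnorm (f x)).
Proof. by have [] := wholP f. Qed.

Lemma whol_pos (f : whol v F) x : U x -> 0 <= v x * rnorm (f x).
Proof. by move=> Ux; rewrite mulr_ge0 ?rnorm_ge0// ltW// weight_gt0. Qed.

Lemma wnorm_ge0 (f : whol v F) : 0 <= wnorm f.
Proof. exact: (sup_image_ge0 (@whol_pos f) (whol_bounded f)). Qed.

Lemma wnorm_bound (f : whol v F) x : U x -> v x * rnorm (f x) <= wnorm f.
Proof. exact: (sup_ubound (whol_bounded f)). Qed.

Lemma ler_wnormD (f g : whol v F) : wnorm (f + g) <= wnorm f + wnorm g.
Proof.
apply: sup_le_bound; first by rewrite addr_ge0// wnorm_ge0.
move=> x Ux; have v0 := ltW (weight_gt0 v Ux).
rewrite (le_trans (ler_wpM2l v0 (ler_rnormD _ _)))// mulrDr.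
by rewrite lerD// wnorm_bound.
Qed.

Lemma wnormZ (a : R[i]) (f : whol v F) :
  wnorm (a *: f) = rnorm (a : R[i]^o) * wnorm f.
Proof.
rewrite /wnorm -sup_imageM ?rnorm_ge0//; last exact: whol_bounded.
- congr (sup _); apply: eq_imagel => x _.
  by rewrite -[X in rnorm X]/(a *: f x) rnormZ mulrCA.
- by move=> x Ux; exact: whol_pos.
Qed.

Let whol_norm (f : whol v F) : R[i] := (wnorm f)%:C%C.

Let whol_normD f g : whol_norm (f + g) <= whol_norm f + whol_norm g.
Proof. by rewrite -rcD lecR ler_wnormD. Qed.

Let whol_normZ (a : R[i]) f : whol_norm (a *: f) = `|a| * whol_norm f.
Proof. by rewrite /whol_norm wnormZ rcM rnormC. Qed.

Let whol_norm0_eq0 f : whol_norm f = 0 -> f = 0.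
Proof.
move=> /(congr1 (@complex.Re R))/= f0; apply: whol_ext => x.
have [Ux|nUx] := pselect (U x); last by have [_ _ ->] := wholP f.
apply: rnorm_eq0; apply/eqP; rewrite eq_le rnorm_ge0 andbT.
by rewrite -(pmulr_rle0 _ (weight_gt0 v Ux)) -f0 wnorm_bound.
Qed.

HB.instance Definition _ := Lmodule_isNormed.Build R[i] (whol v F)
  whol_normD whol_normZ whol_norm0_eq0.

Lemma rnorm_wholE (f : whol v F) : rnorm f = wnorm f.
Proof. by []. Qed.

End whol_lmod.

Section composition.
Context {R : realType} {E : normedModType R[i]} {U : set E} {v : weight U}.
Context {F G : normedModType R[i]}.

Lemma is_whol_comp (A : blin F G) (f : whol v F) : is_whol v (A \o f).
Proof.
have [fd [M fM] f0] := wholP f; split.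
- move=> x Ux; apply: differentiable_comp; first exact: fd.
  by apply: linear_differentiable; exact: (blinP A).2.
- exists (opnorm A * M) => x Ux; have v0 := ltW (weight_gt0 v Ux).
  rewrite (le_trans (ler_wpM2l v0 (opnorm_bound A (f x))))// mulrCA.
  by rewrite ler_wpM2l ?opnorm_ge0// fM.
- by move=> x Ux /=; rewrite f0// linear0.
Qed.

Definition whol_comp (A : blin F G) (f : whol v F) : whol v G :=
  mk_whol (is_whol_comp A f).

Lemma is_blin_scale (phi : blin F R[i]^o) (y : G) :
  is_blin (fun x => phi x *: y).
Proof.
split; first by move=> a x z; rewrite linearP scalerDl -scalerA.
by move=> x; apply: cvgZr_tmp; exact: (blinP phi).2.
Qed.

Definition rank1 (phi : blin F R[i]^o) (y : G) : blin F G :=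
  mk_blin (is_blin_scale phi y).

Lemma is_whol_scale (g : whol v R[i]^o) (y : F) :
  is_whol v (fun x => g x *: y).
Proof.
have [gd [M gM] g0] := wholP g; split.
- by move=> x Ux; apply: differentiableZl; exact: gd.
- exists (M * rnorm y) => x Ux.
  by rewrite rnormZ mulrA ler_wpM2r ?rnorm_ge0// gM.
- by move=> x Ux; rewrite g0// scale0r.
Qed.

Definition whol_scale (g : whol v R[i]^o) (y : F) : whol v F :=
  mk_whol (is_whol_scale g y).

End composition.

Section nuclear.
Context {R : realType}.
Implicit Types (p q : R).
Local Open Scope ereal_scope.

(* The conjugate exponent p^*, i.e. the solution of p^-1 + p^*^-1 = 1. *)
Definition conj_exp p : R := ((1 - p^-1)^-1)%R.

Definition strong_norm p (Z : normedModType R[i]) (z : nat -> Z) : \bar R :=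
  (\sum_(0 <= n <oo) (rnorm (z n) `^ p)%:E) `^ p^-1.

(* The supremum ranges over the closed unit ball of the dual [blin Z R[i]^o]. *)
Definition weak_norm q (Z : normedModType R[i]) (z : nat -> Z) : \bar R :=
  ereal_sup [set strong_norm q (fun n => phi (z n))
            | phi in [set phi : blin Z R[i]^o | (rnorm phi <= 1)%R]].

Definition op_repr p (F G : normedModType R[i]) (A : blin F G)
    (phi : nat -> blin F R[i]^o) (y : nat -> G) : Prop :=
  [/\ weak_norm (conj_exp p) phi < +oo, strong_norm p y < +oo &
      series (fun n => rank1 (phi n) (y n)) @ \oo --> A].

Definition op_nuclear p (F G : normedModType R[i]) (A : blin F G) : Prop :=
  exists phi y, op_repr p A phi y.

(* Extended-real valued: +oo exactly on the non-nuclear operators. *)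
Definition op_nuclear_norm p (F G : normedModType R[i]) (A : blin F G) : \bar R :=
  ereal_inf [set t | exists phi y, op_repr p A phi y /\
                     t = weak_norm (conj_exp p) phi * strong_norm p y].

Section weighted.
Context {E : normedModType R[i]} {U : set E} {v : weight U}.

Definition whol_repr p (F : normedModType R[i]) (f : whol v F)
    (g : nat -> whol v R[i]^o) (y : nat -> F) : Prop :=
  [/\ weak_norm (conj_exp p) g < +oo, strong_norm p y < +oo &
      series (fun n => whol_scale (g n) (y n)) @ \oo --> f].

Definition whol_nuclear p (F : normedModType R[i]) (f : whol v F) : Prop :=
  exists g y, whol_repr p f g y.

Definition whol_nuclear_norm p (F : normedModType R[i])
    (f : whol v F) : \bar R :=
  ereal_inf [set t | exists g y, whol_repr p f g y /\
                     t = weak_norm (conj_exp p) g * strong_norm p y].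

Definition left_quotient p (F : completeNormedModType R[i]) : set (whol v F) :=
  [set f | forall (G : completeNormedModType R[i]) (A : blin F G),
             op_nuclear p A -> whol_nuclear p (whol_comp A f)].

Definition left_quotient_norm p (F : completeNormedModType R[i])
    (f : whol v F) : \bar R :=
  ereal_sup [set t | exists (G : completeNormedModType R[i]) (A : blin F G),
                     [/\ op_nuclear p A, op_nuclear_norm p A <= 1 &
                         t = whol_nuclear_norm p (whol_comp A f)]].

End weighted.
End nuclear.

Arguments left_quotient {R E U} v p F.

(* Main.v *)
From HB Require Import structures.
Require Import Defs.
From mathcomp Require Import all_boot all_order all_algebra complex.
From mathcomp Require Import all_classical all_reals all_analysis.
From mathcomp Require Import ring lra.

(* If [A = \sum_n phi_n (.) y_n], then [A \o f = \sum_n (phi_n \o f) (.) y_n],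
   and [phi |-> phi \o f] is a bounded operator of norm at most [wnorm f] from
   the dual of [F] to the weighted space, so that the quotient norm is at most
   [wnorm f].  Conversely, a Hahn-Banach functional [phi] norming [f x] gives an
   operator [A = phi (.) y] of nuclear norm at most 1 with [|A (f x)| = |f x|]
   ([y] is taken proportional to [f x], so [G = F] suffices), while the nuclear
   norm dominates [wnorm] by Hoelder's inequality applied to the weighted
   evaluations [g |-> v x * g x], which have norm at most 1. *)

Set Implicit Arguments.
Unset Strict Implicit.
Unset Printing Implicit Defensive.

Import Order.TTheory GRing.Theory Num.Theory.
Import numFieldNormedType.Exports.

Local Open Scope classical_set_scope.
Local Open Scope ring_scope.

(** * The Hahn-Banach theorem *)

Section sublinear.
Context {R : realType} {V : lmodType R[i]}.
Implicit Types (p q : V -> R) (x y : V).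

(** Scalars are real, so the complex space is treated as a real one. Asking only an inequality for
    positive [r] is enough, since [r^-1] yields the converse, and it passes more easily to
    infima. *)
Definition sublinear q :=
  (forall x y, q (x + y) <= q x + q y) /\
  (forall r x, 0 < r -> q (r%:C%C *: x) <= r * q x).

Lemma sublinear0 q : sublinear q -> q 0 = 0.
Proof.
move=> [qD qZ]; apply/eqP; rewrite eq_le; apply/andP; split.
  have := qZ 2^-1 0; rewrite scaler0 invr_gt0 ltr0n => /(_ isT).
  by rewrite -subr_ge0 -{2}[q 0]mul1r -mulrBl => h; nra.
by have := qD 0 0; rewrite addr0; lra.
Qed.

Lemma sublinearZ {q r x} : sublinear q -> 0 <= r ->
  q (r%:C%C *: x) = r * q x.
Proof.
move=> qS; rewrite le_eqVlt => /predU1P[<-|r0].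
  by rewrite scale0r mul0r sublinear0.
apply/eqP; rewrite eq_le qS.2//= -ler_pdivlMl//.
apply: le_trans (qS.2 _ _ _); last by rewrite invr_gt0.
by rewrite scalerA -rcM mulVf ?gt_eqF// scale1r.
Qed.

Lemma sublinear_geN {q x} : sublinear q -> - q (- x) <= q x.
Proof.
by move=> qS; have := qS.1 x (- x); rewrite subrr (sublinear0 qS); lra.
Qed.

(** The index [u] may depend on the points, which covers both chains of functionals and the
    one-parameter family behind [line_inf]. *)
Lemma sublinear_inf (T : Type) (q : T -> V -> R) (t0 : T) :
  (forall x, has_lbound (range (q ^~ x))) ->
  (forall s t x y, exists u, q u (x + y) <= q s x + q t y) ->
  (forall t r x, 0 < r -> exists u, q u (r%:C%C *: x) <= r * q t x) ->
  sublinear (fun x => inf (range (q ^~ x))).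
Proof.
move=> qlb qD qZ.
have infle x t : inf (range (q ^~ x)) <= q t x by apply: ge_inf => //; exists t.
have leinf x M : (forall t, M <= q t x) -> M <= inf (range (q ^~ x)).
  move=> Mq; apply: lb_le_inf; first by exists (q t0 x), t0.
  by move=> _ [t _ <-].
split=> [x y|r x r0].
  rewrite -lerBlDr; apply: (leinf) => s; rewrite lerBlDl -lerBlDr.
  apply: (leinf) => t; rewrite lerBlDl; have [u] := qD s t x y.
  by apply: le_trans.
rewrite -ler_pdivrMl//; apply: (leinf) => t; rewrite ler_pdivrMl//.
by have [u] := qZ t r x r0; apply: le_trans.
Qed.

(* The infimum over [t >= 0] of [q (x + t y) - t q y] lies below [q] and takes
   a value at most [- q y] at [- y]. *)
Definition line_inf q y x :=
  inf (range (fun t : {nonneg R} => q (x + t%:num%:C%C *: y) - t%:num * q y)).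

(** Homogeneity and subadditivity give [t q y = q (t y) <= q (x + t y) + q (- x)]. *)
Lemma line_inf_lbound q y x : sublinear q ->
  has_lbound (range (fun t : {nonneg R} =>
    q (x + t%:num%:C%C *: y) - t%:num * q y)).
Proof.
move=> qS; exists (- q (- x)) => _ [t _ <-].
rewrite -(sublinearZ qS)//; have := qS.1 (x + t%:num%:C%C *: y) (- x).
by rewrite addrAC subrr add0r; lra.
Qed.

Lemma line_inf_le q y x (t : R) : sublinear q -> 0 <= t ->
  line_inf q y x <= q (x + t%:C%C *: y) - t * q y.
Proof.
move=> qS t0; apply: ge_inf; first exact: line_inf_lbound.
by exists (NngNum t0).
Qed.

Lemma sublinear_line_inf q y : sublinear q -> sublinear (line_inf q y).
Proof.
move=> qS; apply: (sublinear_inf (0%:nng : {nonneg R})).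
- by move=> x; exact: line_inf_lbound.
- move=> s t x z; exists (s%:num + t%:num)%:nng => /=.
  rewrite rcD scalerDl addrACA mulrDl.
  by have := qS.1 (x + s%:num%:C%C *: y) (z + t%:num%:C%C *: y); lra.
- move=> t r x r0; exists (NngNum (mulr_ge0 (ltW r0) (ge0 t))) => /=.
  rewrite rcM -scalerA -scalerDr (sublinearZ qS (ltW r0)).
  by rewrite mulrBr mulrA.
Qed.

(** Zorn's lemma for the reversed pointwise order: a nonempty chain is bounded by its pointwise
    infimum, which stays above [- p (- x)]. *)
Lemma exists_minimal_sublinear p : sublinear p ->
  exists q, [/\ sublinear q, forall x, q x <= p x &
    forall q', sublinear q' -> (forall x, q' x <= q x) -> q' =1 q].
Proof.
move=> pS; pose T := {q | sublinear q /\ forall x, q x <= p x}.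
pose ge (s t : T) := `[< forall x, sval t x <= sval s x >].
have [| | |A Atot|[q [qS qp]] qmin] := @Zorn T ge.
- by move=> t; apply/asboolP.
- move=> r s t /asboolP rs /asboolP st; apply/asboolP => x.
  exact: le_trans (st x) (rs x).
- move=> [q qP] [q' q'P] /asboolP/= qq' /asboolP/= q'q.
  apply: eq_exist; apply/funext => x; apply/eqP.
  by rewrite eq_le qq' q'q.
- have [A0|/set0P[t0 At0]] := eqVneq A set0.
    by exists (exist _ p (conj pS (fun x => lexx _))) => s; rewrite A0.
  pose q (s : {t | A t}) := sval (sval s).
  have qS s : sublinear (q s) := (svalP (sval s)).1.
  have qp s x : q s x <= p x := (svalP (sval s)).2 x.
  have qlb x : has_lbound (range (q ^~ x)).
    exists (- p (- x)) => _ [s _ <-].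
    by apply: le_trans (sublinear_geN (qS s)); rewrite lerN2 qp.
  have infS : sublinear (fun x => inf (range (q ^~ x))).
    apply: (sublinear_inf (exist _ t0 At0)) => // [s t x y|s r x r0].
      (* Of two comparable functionals the smaller one serves as [u]. *)
      have [/asboolP h|/asboolP h] := Atot _ _ (svalP s) (svalP t).
        by exists t; rewrite (le_trans ((qS t).1 _ _))// lerD2r; exact: h.
      by exists s; rewrite (le_trans ((qS s).1 _ _))// lerD2l; exact: h.
    by exists s; exact: (qS s).2.
  have infle x s : inf (range (q ^~ x)) <= q s x.
    by apply: ge_inf => //; exists s.
  have infp x : inf (range (q ^~ x)) <= p x.
    exact: le_trans (infle x (exist _ t0 At0)) (qp _ _).
  pose infT : T := exist _ (fun x => inf (range (q ^~ x))) (conj infS infp).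
  exists infT => s As; apply/asboolP => x /=.
  exact: (infle x (exist _ s As)).
exists q; split => // q' q'S q'q x.
have q'p y : q' y <= p y by exact: le_trans (q'q y) (qp y).
pose q'T : T := exist _ q' (conj q'S q'p).
by have /(congr1 (fun s : T => sval s x)) := qmin q'T (asboolT q'q).
Qed.

(* A minimal sublinear [q] coincides with [line_inf q y] for every [y]; this
   gives superadditivity. *)
Lemma minimal_sublinear_additive q : sublinear q ->
  (forall q', sublinear q' -> (forall x, q' x <= q x) -> q' =1 q) ->
  forall x y, q (x + y) = q x + q y.
Proof.
move=> qS qmin x y; apply/eqP; rewrite eq_le qS.1/=.
rewrite -(qmin _ (sublinear_line_inf y qS)); last first.
  move=> z; rewrite (le_trans (line_inf_le y z qS (lexx 0)))//.
  by rewrite scale0r addr0 mul0r subr0.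
have := line_inf_le y x qS ler01; rewrite scale1r mul1r; lra.
Qed.

(** A minimal [f] below [line_inf p x0] is additive, and its value at [- x0] is at most
    [p 0 - p x0 = - p x0], hence [p x0 <= f x0]. *)
Lemma sublinear_hahn_banach p x0 : sublinear p ->
  exists f, [/\ forall x y, f (x + y) = f x + f y,
    forall r x, f (r%:C%C *: x) = r * f x,
    forall x, f x <= p x & p x0 <= f x0].
Proof.
move=> pS; have [f [fS fp fmin]] :=
  exists_minimal_sublinear (sublinear_line_inf x0 pS).
have fD := minimal_sublinear_additive fS fmin.
have fN x : f (- x) = - f x.
  apply/eqP; rewrite eq_sym -subr_eq0 -opprD oppr_eq0 -fD subrr.
  by rewrite (sublinear0 fS).
exists f; split => // [r x|x|].
- have [r0|r0] := leP 0 r; first exact: (sublinearZ fS).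
  rewrite -[r]opprK rmorphN scaleNr fN (sublinearZ fS) ?mulNr//.
  by rewrite oppr_ge0 ltW.
- apply: le_trans (fp x) _; apply: le_trans (line_inf_le x0 x pS (lexx 0)) _.
  by rewrite scale0r addr0 mul0r subr0.
- have := le_trans (fp (- x0)) (line_inf_le x0 (- x0) pS ler01).
  rewrite scale1r mul1r addNr (sublinear0 pS) fN; lra.
Qed.

End sublinear.

(** * Continuity and operator norms from linear bounds; complex functionals *)

Section bounded_linear.
Context {R : realType} {V W : normedModType R[i]}.

(** Puts the Hahn-Banach functional, precomposition and weighted evaluation into [blin] from a norm
    estimate alone. *)
Lemma bounded_is_blin (f : V -> W) (k : R) : linear f ->
  (forall x, rnorm (f x) <= k * rnorm x) -> is_blin f.
Proof.
move=> fl fk; split=> //.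
pose f' := HB.pack_for {linear V -> W} f (GRing.isLinear.Build _ _ _ _ f fl).
suff : bounded_near f' (nbhs (0 : V)) by move/bounded_linear_continuous.
apply/linear_boundedP; exists k%:C%C; split; first by rewrite complex_real.
move=> r kr x; rewrite (le_trans (y := k%:C%C * `|x|))//.
  by rewrite -!rnormC -rcM lecR; exact: fk.
by rewrite ler_wpM2r// ltW.
Qed.

Lemma opnorm_le (A : blin V W) (k : R) : 0 <= k ->
  (forall x, rnorm (A x) <= k * rnorm x) -> opnorm A <= k.
Proof.
move=> k0 Ak; apply: sup_le_bound => // x x1.
by rewrite (le_trans (Ak x))// ler_piMr.
Qed.

End bounded_linear.

Lemma complex_hahn_banach {R : realType} {V : normedModType R[i]} (x0 : V) :
  exists phi : blin V R[i]^o, opnorm phi <= 1 /\ rnorm (phi x0) = rnorm x0.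
Proof.
have nS : sublinear (@rnorm R V).
  split=> [x y|r x r0]; first exact: ler_rnormD.
  by rewrite rnormZ (rnorm_rc (ltW r0)).
have [f [fD fZ fle f0]] := sublinear_hahn_banach x0 nS.
(* The only complex linear functional with real part [f]. *)
pose phi x : R[i]^o := (f x -i* f ('i%C *: x))%C.
have phil : linear phi.
  move=> [a b] x y.
  have abE z : (a +i* b)%C *: z = a%:C%C *: z + b%:C%C *: ('i%C *: z).
    rewrite scalerA -scalerDl; congr (_ *: _).
    by apply/eqP; rewrite eq_complex /=; apply/andP; split; apply/eqP; ring.
  have iE z : 'i%C *: ('i%C *: z) = - z.
    rewrite scalerA -scaleN1r; congr (_ *: _).
    by apply/eqP; rewrite eq_complex /=; apply/andP; split; apply/eqP; ring.
  have fN z : f (- z) = - f z.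
    by rewrite -scaleN1r -[in LHS](rmorphN1 (real_complex R)) fZ mulN1r.
  rewrite /phi scalerDr !fD scalerA mulrC -scalerA !abE iE !fD !fZ fN.
  by apply/eqP; rewrite eq_complex /=; apply/andP; split; apply/eqP; ring.
have phile x : rnorm (phi x) <= 1 * rnorm x.
  rewrite mul1r; have [->|n0] := eqVneq (phi x) 0.
    by rewrite rnorm0 rnorm_ge0.
  (* Rotating [x] by the unimodular [w] makes [phi x] real and nonnegative. *)
  pose w : R[i] := (phi x)^*%C / `|phi x|.
  have nw : rnorm (w : R[i]^o) = 1.
    apply: complexI; rewrite rnormC /w normrM normcJ normfV normr_id mulfV//.
    by rewrite normr_eq0.
  have -> : rnorm (phi x) = f (w *: x).
    rewrite -[RHS]/(complex.Re (phi (w *: x))).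
    have := phil w x 0; rewrite addr0.
    have -> : phi 0 = 0.
      have := phil 1 0 0; rewrite !scale1r !addr0 => /eqP.
      by rewrite -subr_eq subrr eq_sym => /eqP.
    rewrite addr0 => ->; congr (complex.Re _).
    rewrite /w -[_ *: _]/(_ * _) mulrAC (mulrC _^*%C) -sqr_normc expr2 -mulrA.
    by rewrite mulfV ?mulr1// normr_eq0.
  by rewrite (le_trans (fle _))// rnormZ nw mul1r.
exists (mk_blin (bounded_is_blin phil phile)); split.
  exact: opnorm_le.
apply/eqP; rewrite eq_le; apply/andP; split.
  by have := phile x0; rewrite mul1r.
(* The chain is [rnorm x0 <= f x0 = Re (phi x0) <= |phi x0|]. *)
apply: le_trans f0 _; rewrite -lecR rnormC; apply: le_trans (normc_ge_Re _).
by rewrite lecR /= ler_norm.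
Qed.

(** * Strongly and weakly summable sequences *)

Section summability.
Context {R : realType}.
Implicit Types (Z W : normedModType R[i]) (p q : R).
Local Open Scope ereal_scope.

Lemma conj_exp_gt0 p : (1 < p)%R -> (0 < conj_exp p)%R.
Proof.
by move=> p1; rewrite invr_gt0 subr_gt0 invf_lt1// (lt_trans _ p1).
Qed.

Lemma conj_expP p : ((conj_exp p)^-1 + p^-1 = 1)%R.
Proof. by rewrite invrK subrK. Qed.

Lemma strong_norm_ge0 p Z (z : nat -> Z) : 0 <= strong_norm p z.
Proof. exact: poweR_ge0. Qed.

Lemma strong_norm_le p (c : R) Z W (z : nat -> Z) (w : nat -> W) :
  (0 < p)%R -> (0 <= c)%R ->
  (forall n, (rnorm (z n) <= c * rnorm (w n))%R) ->
  strong_norm p z <= c%:E * strong_norm p w.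
Proof.
move=> p0 c0 zw; have pw_ge0 n : 0 <= (rnorm (w n) `^ p)%:E.
  by rewrite lee_fin powR_ge0.
(* In this form the constant can be moved under the outer power and then into the series. *)
have -> : c%:E = (c `^ p)%:E `^ p^-1.
  by rewrite poweR_EFin -powRrM mulfV ?gt_eqF// powRr1.
rewrite -poweRM ?lee_fin ?powR_ge0//; last exact: nneseries_ge0.
rewrite -nneseriesZl//.
have zc : \sum_(0 <= n <oo) (rnorm (z n) `^ p)%:E <=
    \sum_(0 <= n <oo) ((c `^ p)%:E * (rnorm (w n) `^ p)%:E).
  apply: lee_nneseries => [n _ _|n _]; first by rewrite lee_fin powR_ge0.
  rewrite -EFinM lee_fin -powRM ?rnorm_ge0//.
  by apply: ge0_ler_powR; rewrite ?nnegrE ?mulr_ge0 ?rnorm_ge0// ltW.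
apply: gt0_ler_poweR => //; rewrite ?invr_ge0 ?ltW// in_itv/= leey andbT.
  by apply: nneseries_ge0 => n _ _; rewrite lee_fin powR_ge0.
by apply: nneseries_ge0 => n _ _; rewrite mule_ge0// lee_fin powR_ge0.
Qed.

Lemma strong_norm_single p Z (z : nat -> Z) : (0 < p)%R ->
  (forall n, z n.+1 = 0%R) -> strong_norm p z = (rnorm (z 0%N))%:E.
Proof.
move=> p0 z0; rewrite /strong_norm (nneseries_split 0 1); last first.
  by move=> k _; rewrite lee_fin powR_ge0.
rewrite eseries0 ?adde0; last first.
  by move=> [//|n] _ _; rewrite z0 rnorm0 powR0 ?gt_eqF.
rewrite big_mkord big_ord_recr big_ord0 /= add0r -powRrM.
by rewrite mulfV ?gt_eqF// powRr1// rnorm_ge0.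
Qed.

Lemma le_strong_norm_weak_norm q Z (z : nat -> Z) (phi : blin Z R[i]^o) :
  (rnorm phi <= 1)%R -> strong_norm q (fun n => phi (z n)) <= weak_norm q z.
Proof. by move=> phi1; apply: ereal_sup_ubound; exists phi. Qed.

Lemma weak_norm_ge0 q Z (z : nat -> Z) : 0 <= weak_norm q z.
Proof.
apply: le_trans (le_strong_norm_weak_norm (phi := 0%R) _ _ _).
  exact: strong_norm_ge0.
by rewrite rnorm0.
Qed.

Lemma strong_norm_dual_le q Z (z : nat -> Z) (chi : blin Z R[i]^o) :
  (0 < q)%R ->
  strong_norm q (fun n => chi (z n)) <= (opnorm chi)%:E * weak_norm q z.
Proof.
move=> q0; have c0 := opnorm_ge0 chi.
(* Since [0^-1 = 0], this is the zero functional when [chi] has norm zero, so it lies in the dual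
   unit ball in every case. *)
pose phi := ((opnorm chi)^-1%:C%C *: chi)%R.
have nV : rnorm ((opnorm chi)^-1%:C%C : R[i]^o) = ((opnorm chi)^-1)%R.
  by rewrite rnorm_rc// invr_ge0.
have phi1 : (rnorm phi <= 1)%R.
  rewrite rnormZ nV rnorm_blinE; have [->|n0] := eqVneq (opnorm chi) 0%R.
    by rewrite mulr0.
  by rewrite mulVf.
apply: le_trans (lee_wpmul2l _ (le_strong_norm_weak_norm _ z phi1)); last first.
  by rewrite lee_fin.
apply: strong_norm_le => // n.
rewrite -[phi (z n)]/(_ *: chi (z n))%R rnormZ nV.
have [c00|n0] := eqVneq (opnorm chi) 0%R; last by rewrite mulrA mulfV// mul1r.
by rewrite {1}c00 mul0r; have := opnorm_bound chi (z n); rewrite c00 mul0r.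
Qed.

Lemma is_blin_comp Z W (V : normedModType R[i]) (A : blin W V) (B : blin Z W) :
  is_blin (A \o B).
Proof.
split; first by move=> a x y /=; rewrite !linearP.
by move=> x; apply: continuous_comp; [exact: (blinP B).2|exact: (blinP A).2].
Qed.

(** For [phi] in the dual unit ball, [phi \o B] is a functional of norm at most [opnorm B]. *)
Lemma weak_norm_map_le q Z W (z : nat -> Z) (B : blin Z W) : (0 < q)%R ->
  weak_norm q (fun n => B (z n)) <= (opnorm B)%:E * weak_norm q z.
Proof.
move=> q0; apply: ge_ereal_sup => _ [phi phi1 <-].
apply: le_trans (strong_norm_dual_le z (mk_blin (is_blin_comp phi B)) q0) _.
apply: lee_wpmul2r; first exact: weak_norm_ge0.
rewrite lee_fin; apply: opnorm_le => [|x /=]; first exact: opnorm_ge0.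
apply: le_trans (opnorm_bound phi (B x)) _.
apply: le_trans (opnorm_bound B x).
by rewrite ler_piMl ?rnorm_ge0.
Qed.

(** Hoelder's inequality for the counting measure on the naturals, stated for partial sums because
    the later limit argument starts from these. *)
Lemma hoelder_series p q Z W (z : nat -> Z) (w : nat -> W) (N : nat) :
  (0 < p)%R -> (0 < q)%R -> (p^-1 + q^-1 = 1)%R ->
  (\sum_(n < N) (rnorm (z n) * rnorm (w n)))%R%:E <=
  strong_norm p z * strong_norm q w.
Proof.
move=> p0 q0 pq; pose a n := rnorm (z n); pose b n := rnorm (w n).
have ma (f : nat -> R) : measurable_fun setT f by [].
have := hoelder counting (ma a) (ma b) p0 q0 pq.
rewrite (Lnorm_counting _ ltr01) (Lnorm_counting _ p0) (Lnorm_counting _ q0) invr1 => ab.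
have -> : strong_norm p z = (\sum_(0 <= k <oo) `|(EFin \o a) k| `^ p) `^ p^-1.
  congr (_ `^ _); apply: eq_eseriesr => n _ /=.
  by rewrite ger0_norm ?rnorm_ge0.
have -> : strong_norm q w = (\sum_(0 <= k <oo) `|(EFin \o b) k| `^ q) `^ q^-1.
  congr (_ `^ _); apply: eq_eseriesr => n _ /=.
  by rewrite ger0_norm ?rnorm_ge0.
apply: le_trans ab.
rewrite poweRe1; last by apply: nneseries_ge0 => n _ _; exact: poweR_ge0.
apply: le_trans (nneseries_lim_ge N _); last by move=> *; exact: poweR_ge0.
rewrite -sumEFin big_mkord; apply: lee_sum => n _.
by rewrite poweRe1//= ger0_norm ?mulr_ge0 ?rnorm_ge0.
Qed.

End summability.

(** * Nuclear weighted holomorphic maps *)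

Section weighted.
Context {R : realType} {E : normedModType R[i]} {U : set E} {v : weight U}.
Implicit Types (F G : normedModType R[i]) (p q : R).

Lemma wnorm_comp_le F G (A : blin F G) (f : whol v F) :
  wnorm (whol_comp A f) <= wnorm f * opnorm A.
Proof.
apply: sup_le_bound; first by rewrite mulr_ge0 ?wnorm_ge0 ?opnorm_ge0.
move=> x Ux /=; have v0 := ltW (weight_gt0 v Ux).
apply: le_trans (ler_wpM2l v0 (opnorm_bound A (f x))) _.
by rewrite mulrCA mulrC ler_wpM2r ?opnorm_ge0// wnorm_bound.
Qed.

Lemma precomp_linear F G (f : whol v F) :
  linear (fun A : blin F G => whol_comp A f).
Proof. by move=> a A B; apply: whol_ext. Qed.

(** Serves twice: with scalar target it carries the functionals of a nuclear representation into the
    weighted space, with target [G] it carries the series itself. *)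
Definition precomp {F} G (f : whol v F) : blin (blin F G) (whol v G) :=
  mk_blin (bounded_is_blin (@precomp_linear F G f) (fun A => wnorm_comp_le A f)).

Lemma opnorm_precomp_le F G (f : whol v F) : opnorm (precomp G f) <= wnorm f.
Proof.
by apply: opnorm_le => [|A]; [exact: wnorm_ge0|exact: wnorm_comp_le].
Qed.

Lemma eval_linear F (x : E) : linear (fun g : whol v F => (v x)%:C%C *: g x).
Proof.
by move=> a g h; rewrite scalerA mulrC -scalerA -scalerDr.
Qed.

Lemma eval_bounded F (x : E) (g : whol v F) : U x ->
  rnorm ((v x)%:C%C *: g x) <= 1 * rnorm g.
Proof.
move=> Ux; rewrite mul1r rnormZ rnorm_rc ?(ltW (weight_gt0 v Ux))//.
exact: wnorm_bound.
Qed.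

(** The factor [v x] makes evaluation at [x] a contraction; for scalar [F] this is a functional in
    the dual unit ball. *)
Definition weighted_eval F (x : E) (Ux : U x) : blin (whol v F) F :=
  mk_blin (bounded_is_blin (@eval_linear F x) (fun g => eval_bounded g Ux)).

Lemma opnorm_weighted_eval_le F x (Ux : U x) : opnorm (weighted_eval F Ux) <= 1.
Proof. by apply: opnorm_le => // g; exact: eval_bounded. Qed.

Lemma whol_repr_comp p F G (A : blin F G) phi y (f : whol v F) :
  0 < conj_exp p -> op_repr p A phi y ->
  whol_repr p (whol_comp A f) (fun n => whol_comp (phi n) f) y.
Proof.
move=> q0 [phioo yoo phiA]; split=> //.
  apply: le_lt_trans (weak_norm_map_le _ (precomp R[i]^o f) q0) _.
  by rewrite lte_mul_pinfty ?lee_fin ?opnorm_ge0.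
(* The partial sums are images under the linear map [precomp G f], so its continuity gives
   convergence. *)
have -> : series (fun n => whol_scale (whol_comp (phi n) f) (y n)) =
    precomp G f \o series (fun n => rank1 (phi n) (y n)).
  apply/funext => n; rewrite /series/= -[RHS]/(precomp G f _) linear_sum.
  by apply: eq_bigr => k _; exact: whol_ext.
by apply: continuous_cvg phiA; exact: (blinP (precomp G f)).2.
Qed.

Lemma whol_nuclear_comp p F G (A : blin F G) (f : whol v F) :
  0 < conj_exp p -> op_nuclear p A -> whol_nuclear p (whol_comp A f).
Proof.
move=> q0 [phi [y Ay]]; exists (fun n => whol_comp (phi n) f), y.
exact: whol_repr_comp.
Qed.

Local Open Scope ereal_scope.

(** Composition with [f] turns each representation of [A] into one of [A \o f], its weak norm
    growing by a factor of at most [wnorm f]; the infimum is then taken. *)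
Lemma whol_nuclear_norm_comp_le p F G (A : blin F G) (f : whol v F) :
  (0 < conj_exp p)%R -> op_nuclear p A ->
  whol_nuclear_norm p (whol_comp A f) <= (wnorm f)%:E * op_nuclear_norm p A.
Proof.
move=> q0 [phi0 [y0 Ay0]].
have le_repr phi y : op_repr p A phi y ->
    whol_nuclear_norm p (whol_comp A f) <=
    (wnorm f)%:E * (weak_norm (conj_exp p) phi * strong_norm p y).
  move=> Ay; apply: ge_ereal_inf; eexists.
    by exists (fun n => whol_comp (phi n) f), y; split; [exact: whol_repr_comp|].
  rewrite muleA lee_wpmul2r ?strong_norm_ge0//.
  apply: le_trans (weak_norm_map_le _ (precomp R[i]^o f) q0) _.
  by rewrite lee_wpmul2r ?weak_norm_ge0// lee_fin opnorm_precomp_le.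
(* Only a positive constant is pulled out of the infimum below; if it is zero, a single
   representation already gives the bound 0. *)
have [f0|] := eqVneq (wnorm f) 0%R.
  by have := le_repr _ _ Ay0; rewrite f0 !mul0e.
move=> f0; have {}f0 : (0 < wnorm f)%R by rewrite lt_neqAle eq_sym f0 wnorm_ge0.
rewrite -ereal_inf_pZl//; apply: le_ereal_inf_tmp.
by move=> _ [_ [phi [y [Ay ->]]] <-]; exact: le_repr.
Qed.

(** Weighted evaluation at [x] turns the representation into a series of scalars times vectors in
    [F]; Hoelder bounds its partial sums, and the bound survives the limit. *)
Lemma whol_repr_bound p F (h : whol v F) g y x : (1 < p)%R -> U x ->
  whol_repr p h g y ->
  (v x * rnorm (h x))%:E <= weak_norm (conj_exp p) g * strong_norm p y.
Proof.
move=> p1 Ux [goo yoo gh].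
have p0 : (0 < p)%R by exact: lt_trans p1.
have q0 := conj_exp_gt0 p1.
pose e := weighted_eval F Ux; pose eC := weighted_eval R[i]^o Ux.
have v0 := ltW (weight_gt0 v Ux).
have -> : (v x * rnorm (h x) = rnorm (e h))%R by rewrite /e/= rnormZ rnorm_rc.
have eS N : (rnorm (e (series (fun n => whol_scale (g n) (y n)) N)))%:E <=
    weak_norm (conj_exp p) g * strong_norm p y.
  (* The scalars [v x * g n x] are the values of one functional in the dual unit ball, so the weak
     norm of [g] dominates their strong norm. *)
  apply: (@le_trans _ _
      (strong_norm (conj_exp p) (fun n => eC (g n)) * strong_norm p y)); last first.
    rewrite lee_wpmul2r ?strong_norm_ge0//; apply: le_strong_norm_weak_norm.
    by rewrite rnorm_blinE opnorm_weighted_eval_le.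
  apply: le_trans (hoelder_series _ _ N q0 p0 (conj_expP p)).
  rewrite lee_fin /series/= -[(_ *: _)%R]/(e _) linear_sum big_mkord.
  elim/big_ind2: _ => [|a a' b b' ab ab'|n _]; first by rewrite rnorm0.
    exact: le_trans (ler_rnormD _ _) (lerD ab ab').
  by rewrite -rnormZ /e/= scalerA.
have Moo : weak_norm (conj_exp p) g * strong_norm p y \is a fin_num.
  by rewrite fin_numM// ge0_fin_numE ?weak_norm_ge0 ?strong_norm_ge0.
move: Moo eS => /fineK <-; set M := fine _ => eS.
(* A partial sum within [eps] of [h] is evaluated with error at most [eps], as [e] is a
   contraction. *)
rewrite lee_fin; apply/ler_addgt0Pl => eps eps0.
have /cvgrPdist_lt/(_ eps%:C%C) := gh; rewrite ltcR => /(_ eps0)[N _ hN].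
pose s := series (fun n => whol_scale (g n) (y n)) N.
have hs : (`|h - s| < eps%:C%C)%R := hN N (leqnn N).
have -> : e h = (e (h - s) + e s)%R by rewrite linearB subrK.
apply: le_trans (ler_rnormD _ _) _; apply: lerD; last by rewrite -lee_fin eS.
apply: le_trans (eval_bounded _ Ux) _.
by rewrite mul1r ltW// -ltcR rnormC.
Qed.

Lemma wnorm_le_nuclear_norm p F (h : whol v F) : (1 < p)%R ->
  (wnorm h)%:E <= whol_nuclear_norm p h.
Proof.
move=> p1; apply: le_ereal_inf_tmp => _ [g [y [hgy ->]]].
have [goo yoo _] := hgy.
have M0 : 0 <= weak_norm (conj_exp p) g * strong_norm p y.
  by rewrite mule_ge0 ?weak_norm_ge0 ?strong_norm_ge0.
have /fineK ME : weak_norm (conj_exp p) g * strong_norm p y \is a fin_num.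
  by rewrite fin_numM// ge0_fin_numE ?weak_norm_ge0 ?strong_norm_ge0.
(* Nonnegativity of the bound covers an empty [U], where the supremum is 0. *)
rewrite -ME lee_fin; apply: sup_le_bound => [|x Ux]; first exact: fine_ge0.
by rewrite -lee_fin ME; exact: whol_repr_bound.
Qed.

End weighted.

(** * Rank-one operators: nuclear norm and norming property *)

Section rank_one.
Context {R : realType} {F G : normedModType R[i]}.
Local Open Scope ereal_scope.

Lemma op_repr_rank1 (p : R) (phi : blin F R[i]^o) (y : G) : (1 < p)%R ->
  op_repr p (rank1 phi y) (fun n => if n is 0 then phi else 0%R)
    (fun n => if n is 0 then y else 0%R) /\
  weak_norm (conj_exp p) (fun n => if n is 0 then phi else 0%R) *
    strong_norm p (fun n => if n is 0 then y else 0%R) <=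
  (opnorm phi * rnorm y)%:E.
Proof.
move=> p1; have p0 : (0 < p)%R by exact: lt_trans p1.
have q0 := conj_exp_gt0 p1.
set phi_ := (fun n : nat => _); set y_ := (fun n : nat => _).
have yE : strong_norm p y_ = (rnorm y)%:E by rewrite strong_norm_single.
have phile : weak_norm (conj_exp p) phi_ <= (opnorm phi)%:E.
  apply: ge_ereal_sup => _ [psi psi1 <-].
  rewrite strong_norm_single//; last by move=> n; rewrite linear0.
  rewrite lee_fin; apply: le_trans (opnorm_bound psi phi) _.
  by rewrite ler_piMl ?rnorm_ge0.
split; last by rewrite yE EFinM lee_wpmul2r ?lee_fin ?rnorm_ge0.
split; first exact: le_lt_trans phile (ltry _).
  by rewrite yE ltry.
(* [series u n] sums the indices below [n], so the partial sums are constant from [n = 1] on. *)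
apply: cvg_near_cst; exists 1%N => // n /= n1.
rewrite /series/= big_ltn// big_nat big1 ?addr0// => -[//|k] _.
by apply: blin_ext => x /=; rewrite scaler0.
Qed.

Lemma op_nuclear_rank1 (p : R) (phi : blin F R[i]^o) (y : G) : (1 < p)%R ->
  op_nuclear p (rank1 phi y).
Proof. by move=> p1; do 2 eexists; exact: (op_repr_rank1 phi y p1).1. Qed.

Lemma op_nuclear_norm_rank1_le (p : R) (phi : blin F R[i]^o) (y : G) :
  (1 < p)%R -> op_nuclear_norm p (rank1 phi y) <= (opnorm phi * rnorm y)%:E.
Proof.
move=> p1; have [rep le] := op_repr_rank1 phi y p1.
by apply: ge_ereal_inf; eexists; [do 2 eexists; split; [exact: rep|]|exact: le].
Qed.

End rank_one.

Lemma exists_nuclear_norming {R : realType} {F : normedModType R[i]} (p : R)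
    (z : F) : 1 < p ->
  exists A : blin F F, [/\ op_nuclear p A, (op_nuclear_norm p A <= 1)%E &
    rnorm (A z) = rnorm z].
Proof.
move=> p1; have [phi [phi1 phiz]] := complex_hahn_banach z.
(* Normalised so that the product of the norms of [phi] and [y] is at most 1; for [z = 0] the
   convention [0^-1 = 0] gives [y = 0]. *)
pose y := (rnorm z)^-1%:C%C *: z.
have yE : rnorm y = (rnorm z)^-1 * rnorm z.
  by rewrite rnormZ rnorm_rc// invr_ge0 rnorm_ge0.
have [z0|z0] := eqVneq (rnorm z) 0.
  exists (rank1 phi y); split; first exact: op_nuclear_rank1.
    apply: le_trans (op_nuclear_norm_rank1_le _ _ p1) _.
    by rewrite yE z0 !mulr0 lee_fin.
  by rewrite (rnorm_eq0 z0) linear0.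
exists (rank1 phi y); split; first exact: op_nuclear_rank1.
  apply: le_trans (op_nuclear_norm_rank1_le _ _ p1) _.
  by rewrite yE mulVf// mulr1 lee_fin.
by rewrite rnormZ phiz yE mulVf// mulr1.
Qed.

(** * The left-hand quotient and its norm *)

Theorem mainTheorem6 :
  forall (R : realType) (p : R), 1 < p ->
  forall (E : completeNormedModType R[i]) (U : set E), open U ->
  forall (v : weight U) (F : completeNormedModType R[i]),
    left_quotient v p F = [set: whol v F] /\
    forall f : whol v F, left_quotient_norm p f = (wnorm f)%:E.
Proof.
move=> R p p1 E U _ v F; have q0 := conj_exp_gt0 p1; split.
  apply/seteqP; split=> // f _ G A; exact: whol_nuclear_comp.
move=> f; apply/eqP; rewrite eq_le; apply/andP; split.
  apply: ge_ereal_sup => _ [G [A [An A1 ->]]].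
  apply: le_trans (whol_nuclear_norm_comp_le f q0 An) _.
  by rewrite -[leRHS]mule1 lee_wpmul2l// lee_fin wnorm_ge0.
have le_norming x : exists2 A : blin F F, rnorm (A (f x)) = rnorm (f x) &
    ((wnorm (whol_comp A f))%:E <= left_quotient_norm p f)%E.
  have [A [An A1 Afx]] := exists_nuclear_norming (f x) p1; exists A => //.
  apply: le_trans (wnorm_le_nuclear_norm _ p1) _.
  by apply: ereal_sup_ubound; exists F, A.
(* The quotient norm is an extended real; the value [-oo] is excluded by the real lower bounds just
   obtained. *)
move: le_norming; case: (left_quotient_norm p f) => [M| |] le_norming.
- rewrite lee_fin; apply: sup_le_bound => [|x Ux].
    (* The point 0 is arbitrary: any operator so obtained shows [M] nonnegative, as the supremum
       over a possibly empty [U] requires. *)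
    have [A _] := le_norming 0; rewrite lee_fin; apply: le_trans.
    exact: wnorm_ge0.
  have [A Afx] := le_norming x; rewrite lee_fin; apply: le_trans.
  by rewrite -Afx; exact: (wnorm_bound (whol_comp A f) Ux).
- exact: leey.
- by have [A _] := le_norming 0; rewrite leeNy_eq.
Qed.
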